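(* Suppose $r$ and $n$ are positive integers such that $(n,r)>1$. Then: (1) If $\langle n,r\rangle\in\{2,3\}$, then $\mathrm{mincol}_r T(2,n)=\langle n,r\rangle$. (2) If $\langle n,r\rangle=5$, then $\mathrm{mincol}_r T(2,n)=4$. (3) If $\langle n,r\rangle=2k+1$ for some integer $k>2$, then $3<\mathrm{mincol}_r T(2,n)\le k+2$.
   Context: For positive integers $l,m$: $(l,m)$ is their greatest common divisor, and $\langle l,m\rangle$ is $1$ if $(l,m)=1$ and the least common prime divisor of $l$ and $m$ otherwise. Let $r>1$ be an integer, and let $D$ be a diagram of a knot or link $K$. An $r$-coloring (Fox coloring) of $D$ is an assignment of an element of $\mathbb{Z}_r=\mathbb{Z}/r\mathbb{Z}$ (a color) to each arc of $D$ such that at each crossing the sum of the colors of the two under-arcs minus twice the color of the over-arc is $0$ mod $r$. It is trivial if all arcs receive the same color, and non-trivial otherwise. Whether $D$ admits a non-trivial $r$-coloring does not depend on the diagram $D$ of $K$. If $K$ admits non-trivial $r$-colorings, then for a diagram $D$ of $K$ let $n_{r,K}(D)$ be the minimum number of distinct colors used by a non-trivial $r$-coloring of $D$, and set $\mathrm{mincol}_r K:=\min\{n_{r,K}(D) : D \text{ is a diagram of } K\}$. $T(2,n)$ is the torus link (a knot for odd $n$, a two-component link for even $n$) obtained as the closure of the two-strand braid $\sigma_1^n$, $\sigma_1\in B_2$. If $(n,r)>1$ it admits non-trivial $r$-colorings. *)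

(* Defs.v *)
From Stdlib Require Import Relation_Operators.
From HB Require Import structures.
From mathcomp Require Import all_boot all_algebra.
From mathcomp Require Import boolp classical_sets.

Set Implicit Arguments.
Unset Strict Implicit.
Unset Printing Implicit Defensive.

Import GRing.Theory.
Local Open Scope nat_scope.
Local Open Scope classical_set_scope.

(* Unoriented link diagrams in the plane, up to planar isotopy.  Every diagram
   can be put in general position with respect to the height function, and is
   then cut by horizontal lines into slabs containing exactly one minimum
   ([cup]), one maximum ([cap]) or one crossing, all other strands running
   vertically.  Slabs are listed from bottom to top. *)

(* [crossing true]: the over-strand joins the bottom left end to the top right
   end; [crossing false]: it joins the bottom right end to the top left end. *)
Variant piece := cup | cap | crossing of bool.

Definition ins (e : piece) : nat := if e is cup then 0 else 2.
Definition outs (e : piece) : nat := if e is cap then 0 else 2.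

(* [(e, i)]: the piece [e] with exactly [i] vertical strands on its left. *)
Definition slab : Type := piece * nat.

(* The number of strands leaving a stack of slabs entered by [m] strands, or
   [None] if the slabs do not fit. *)
Fixpoint width (m : nat) (D : seq slab) : option nat :=
  if D is (e, i) :: D' then
    if i + ins e <= m then width (m - ins e + outs e) D' else None
  else Some m.

Record diagram := Diagram {
  slabs :> seq slab;
  slabs_closed : width 0 slabs == Some 0
}.

HB.instance Definition _ := [isSub for slabs].

(* The Reidemeister moves, together with the moves by which planar isotopy
   acts on diagrams in general position ([exchange], [zigzagl], [zigzagr],
   [slide_cup], [slide_cap]).  Two diagrams represent isotopic links if and
   only if they are connected by these moves (Reidemeister; Freyd-Yetter and
   Turaev for the version with a height function). *)
Inductive local_move : seq slab -> seq slab -> Prop :=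
| exchange e f i k :
    local_move [:: (e, i); (f, i + outs e + k)]
               [:: (f, i + ins e + k); (e, i)]
| zigzagl i : local_move [:: (cup, i); (cap, i.+1)] [::]
| zigzagr i : local_move [:: (cup, i.+1); (cap, i)] [::]
| slide_cup b i :
    local_move [:: (cup, i); (crossing b, i.+1)]
               [:: (cup, i.+1); (crossing (~~ b), i)]
| slide_cap b i :
    local_move [:: (crossing b, i); (cap, i.+1)]
               [:: (crossing (~~ b), i.+1); (cap, i)]
| reidemeister1_cup b i :
    local_move [:: (cup, i); (crossing b, i)] [:: (cup, i)]
| reidemeister1_cap b i :
    local_move [:: (crossing b, i); (cap, i)] [:: (cap, i)]
| reidemeister2 b i :
    local_move [:: (crossing b, i); (crossing (~~ b), i)] [::]
(* The side condition excludes the triangle in which each of the three strands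
   passes over one of the others and under the other one. *)
| reidemeister3 a b c i of (b == a) || (b == c) :
    local_move [:: (crossing a, i); (crossing b, i.+1); (crossing c, i)]
               [:: (crossing c, i.+1); (crossing b, i); (crossing a, i.+1)].

Definition move (D D' : diagram) : Prop :=
  exists A B s t, [/\ local_move s t, slabs D = A ++ s ++ B
                    & slabs D' = A ++ t ++ B].

Definition isotopic : diagram -> diagram -> Prop :=
  clos_refl_sym_trans diagram move.

(* A link is identified with the set of all its diagrams. *)
Definition link_of (D : diagram) : set diagram := [set D' | isotopic D D'].

Lemma width_crossings (b : bool) (n m : nat) (D : seq slab) :
  width m.+2 (nseq n (crossing b, 0) ++ D) = width m.+2 D.
Proof. by elim: n => //= n IHn; rewrite subn2 addn2. Qed.

Definition torus2_slabs (n : nat) : seq slab :=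
  [:: (cup, 0); (cup, 1)] ++ nseq n (crossing true, 0)
    ++ [:: (cap, 1); (cap, 0)].

Lemma torus2_closed (n : nat) : width 0 (torus2_slabs n) == Some 0.
Proof. by rewrite /= width_crossings. Qed.

(* The standard closure of the two-strand braid with [n] equal crossings: the
   braid strands are in positions 0 and 1, the closing strands in 2 and 3. *)
Definition torus2_diagram (n : nat) : diagram := Diagram (torus2_closed n).

Definition torus2 (n : nat) : set diagram := link_of (torus2_diagram n).

Section Colorings.
Variable r : nat.
Local Open Scope ring_scope.

(* Admissible colors of the strands entering and leaving a slab: colors are
   carried along strands and change only where a strand passes under. *)
Variant colored_slab : slab -> seq 'Z_r -> seq 'Z_r -> Prop :=
| colored_cup u v x :
    colored_slab (cup, size u) (u ++ v) (u ++ [:: x; x] ++ v)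
| colored_cap u v x :
    colored_slab (cap, size u) (u ++ [:: x; x] ++ v) (u ++ v)
| colored_crossing_left u v x y z of y + z - x *+ 2 = 0 :
    colored_slab (crossing true, size u)
      (u ++ [:: x; y] ++ v) (u ++ [:: z; x] ++ v)
| colored_crossing_right u v x y z of x + z - y *+ 2 = 0 :
    colored_slab (crossing false, size u)
      (u ++ [:: x; y] ++ v) (u ++ [:: y; z] ++ v).

(* [c] lists, for every slab, the colors of the strands leaving it. *)
Fixpoint coloring_from (w : seq 'Z_r) (D : seq slab) (c : seq (seq 'Z_r)) :
    Prop :=
  match D, c with
  | [::], [::] => w = [::]
  | s :: D', w' :: c' => colored_slab s w w' /\ coloring_from w' D' c'
  | _, _ => False
  end.

Definition coloring (D : diagram) : set (seq (seq 'Z_r)) :=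
  [set c | coloring_from [::] D c].

(* Every arc crosses some line between two slabs, so [flatten c] contains
   exactly the colors of the arcs. *)
Definition trivial_coloring (c : seq (seq 'Z_r)) : bool :=
  constant (flatten c).

Definition num_colors (c : seq (seq 'Z_r)) : nat := size (undup (flatten c)).

End Colorings.

(* The least element of [P], and 0 if [P] is empty. *)
Definition minimum (P : set nat) : nat :=
  if pselect (exists m, `[< P m >]) is left exP then ex_minn exP else 0.

Definition min_colors (r : nat) (D : diagram) : nat :=
  minimum [set num_colors c | c in
             [set c | coloring (r := r) D c /\ ~~ trivial_coloring c]].

Definition mincol (r : nat) (K : set diagram) : nat :=
  minimum [set min_colors r D | D in K].

Definition least_common_prime (l m : nat) : nat :=
  if coprime l m then 1 else pdiv (gcdn l m).

(* Main.v *)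
Require Import Defs.
From Stdlib Require Import Relation_Operators.
From mathcomp Require Import all_boot all_algebra.
From mathcomp Require Import boolp classical_sets.

Set Implicit Arguments.
Unset Strict Implicit.
Unset Printing Implicit Defensive.

Import GRing.Theory Num.Theory.

(* At a crossing the under-colors y, z and the over-color x satisfy
   z = kei x y := 2x - y, an operation which makes sense in every abelian group
   and turns it into an involutory quandle.  Along an isotopy, a coloring of one
   diagram is carried to a coloring of the other one whose colors generate the
   same subquandle.  Two consequences for T(2,n): nontrivial colorings exist on
   every diagram, and in any abelian group all differences of colors of a
   coloring are killed by n.

   Lower bounds.  If the least prime p dividing (n,r) is at least 3 and a
   nontrivial coloring has only two colors, there is no crossing with distinct
   under-colors, because differences of colors have no 2-torsion.  If p >= 5
   and there are three colors, then, as differences have no 3-torsion either,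
   only one of the colors can be the midpoint of the other two.  In both cases
   the colors can be replaced by integers (-1, 0, 1 with 0 for the midpoint),
   which gives a nontrivial coloring by integers; this is impossible since n
   kills no nonzero integer.

   Upper bounds.  With p = 2k+1, the braid s_0^p is isotopic to the tangle
   s_0^k, (a minimum), s_1^k s_0 s_1, (a maximum): the braid relation
   s_1^k s_0 s_1 = s_0 s_1 s_0^k leaves a kink.  In the second form the colors
   0, d, ..., (k+1)d suffice, where d = r/p, and the colors at the two ends
   agree, so that n/p copies of it can be stacked. *)

(** * Invariance of colorings *)

Section Runs.
Variable V : zmodType.
Local Open Scope ring_scope.
Implicit Types (x y z : V) (w : seq V) (S : pred V) (c : seq (seq V)).

Definition kei x y : V := x *+ 2 - y.

Lemma keixx x : kei x x = x.
Proof. by rewrite /kei mulr2n addrK. Qed.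

Lemma keiK x : involutive (kei x).
Proof. by move=> y; rewrite /kei opprB addrC subrK. Qed.

Lemma kei_distr x y z : kei x (kei y z) = kei (kei x y) (kei x z).
Proof.
have dblB u v : (u - v) *+ 2 = u + u - (v + v) :> V.
  by rewrite mulr2n addrACA opprD.
rewrite /kei dblB !opprB [RHS]addrC.
rewrite -[x *+ 2 + x *+ 2 - _]addrA addrA subrK (mulr2n y).
by rewrite addrCA.
Qed.

(** Reflection in [kei x y] is reflection in [y] conjugated by reflection in [x]; this is
    Reidemeister III in terms of colors. *)
Lemma kei_keil x y z : kei x (kei (kei x y) z) = kei y (kei x z).
Proof. by rewrite kei_distr keiK. Qed.

(** Boolean form of the rules of [colored_slab], over any abelian group because the lower bounds
    need colorings by integers. *)
Definition piece_step (e : piece) w w' : bool :=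
  match e, w, w' with
  | cup, _, x :: y :: v => (x == y) && (w == v)
  | cap, x :: y :: v, _ => (x == y) && (w' == v)
  | crossing true, x :: y :: v, z :: t :: v' =>
      [&& z == kei x y, t == x & v' == v]
  | crossing false, x :: y :: v, z :: t :: v' =>
      [&& z == y, t == kei y x & v' == v]
  | _, _, _ => false
  end.

Fixpoint step (e : piece) (i : nat) w w' : bool :=
  match i, w, w' with
  | 0%N, _, _ => piece_step e w w'
  | i'.+1, x :: v, y :: v' => (x == y) && step e i' v v'
  | _, _, _ => false
  end.

(** Unlike in [coloring_from], the last row is unconstrained, so that runs can be cut and glued. *)
Fixpoint run w (D : seq slab) c : bool :=
  match D, c with
  | [::], [::] => true
  | (e, i) :: D', w' :: c' => step e i w w' && run w' D' c'
  | _, _ => false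
  end.

Definition kei_closed S := forall x y, S x -> S y -> S (kei x y).

(** Testing against all closed predicates compares the generated subquandles without constructing
    them. *)
Definition same_hull (s t : seq V) :=
  forall S, kei_closed S -> all S s = all S t.

(* The local form of the fact that isotopic diagrams have the same colorings:
   colors at the two ends are kept, and the colors used inside generate the
   same subquandle.  The condition on [width] is there because [t] may need more
   strands than [s], as when [s] is empty. *)
Definition transfers (s t : seq slab) :=
  forall w c, run w s c -> width (size w) t ->
  exists c', [/\ run w t c', last w c' = last w c
               & same_hull (flatten (w :: c)) (flatten (w :: c'))].

Lemma closed_keiE S x y : kei_closed S -> S x -> S (kei x y) = S y.
Proof.
move=> Scl Sx; apply/idP/idP; last exact: Scl.
by move=> Sk; rewrite -(keiK x y); apply: Scl.
Qed.

Definition shift (s : seq slab) : seq slab := [seq (p.1, p.2.+1) | p <- s].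

Lemma width_shift m s : width m.+1 (shift s) = omap S (width m s).
Proof.
elim: s m => //= -[e i] s IHs m /=; rewrite addSn ltnS.
case: leqP => //= le_m; rewrite -IHs subSn ?addSn //.
exact: leq_trans (leq_addl i _) le_m.
Qed.

Lemma run_shift x w s c :
  run (x :: w) (shift s) c ->
  exists2 c1, c = [seq x :: v | v <- c1] & run w s c1.
Proof.
elim: s w c => [|[e i] s IHs] w [|w' c] //=; first by exists [::].
case: w' => //= y w' /andP[/andP[/eqP <- st]] /IHs[c1 -> run1].
by exists (w' :: c1); rewrite //= st.
Qed.

Lemma shift_run x w s c :
  run w s c -> run (x :: w) (shift s) [seq x :: v | v <- c].
Proof.
elim: s w c => [|[e i] s IHs] w [|w' c] //= /andP[-> /IHs ->].
by rewrite eqxx.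
Qed.

(** The added left strand keeps one color throughout, hence contributes the same color to both
    sides. This reduces all local moves to position 0. *)
Lemma transfers_shift s t : transfers s t -> transfers (shift s) (shift t).
Proof.
move=> st [|x w] c.
  case: t st => [|[e i] t] st; last by [].
  case: s st => [|[e i] s] st; first by case: c => // _ _; exists [::].
  by case: c.
case/run_shift=> c1 -> run1; rewrite width_shift.
have {}st := st _ _ run1; case W: (width _ _) st => //= st _.
have [//|c2 [run2 l2 h2]] := st.
exists [seq x :: v | v <- c2]; split; first exact: shift_run.
  by rewrite !last_map l2.
have hullE S (d : seq (seq V)) :
    all S (flatten [seq x :: v | v <- w :: d]) = S x && all S (flatten (w :: d)).
  elim: d (w) => [|v d IHd] v' /=; first by rewrite !cats0.
  have {}IHd := IHd v; rewrite /= in IHd.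
  rewrite !all_cat /= all_cat in IHd *; move: IHd.
  by case: (S x); case: (all S v'); case: (all S v) => //= ->.
by move=> S Scl; move: (hullE S c1) (hullE S c2) => /= -> ->; rewrite (h2 S Scl).
Qed.

Lemma kei_fix x y : (kei x y == x) = (y == x).
Proof. by rewrite -{2}(keixx x) (inj_eq (can_inj (keiK x))). Qed.

(* [x] is the color given to each new arc. *)
Definition piece_out x (e : piece) w : seq V :=
  match e, w with
  | cup, _ => x :: x :: w
  | cap, _ :: _ :: v => v
  | crossing true, y :: z :: v => kei y z :: y :: v
  | crossing false, y :: z :: v => z :: kei z y :: v
  | _, _ => w
  end.

Fixpoint step_out x (e : piece) (i : nat) w : seq V :=
  match i, w with
  | 0%N, _ => piece_out x e w
  | i'.+1, y :: v => y :: step_out x e i' v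
  | _, _ => w
  end.

(** Only a minimum leaves a color free, so a choice of [x] determines a candidate coloring for the
    other side of a move. Equality of colors at a maximum is tested only when the result is fed to
    [run]. *)
Fixpoint trace x w (D : seq slab) : seq (seq V) :=
  if D is (e, i) :: D' then
    let w' := step_out x e i w in w' :: trace x w' D'
  else [::].

Ltac split_run := repeat match goal with
  | H : is_true false |- _ => discriminate H
  | H : is_true (_ && _) |- _ => case/andP: H => ? ?
  | H : is_true true |- _ => clear H
  | H : is_true (kei ?x _ == ?x) |- _ => rewrite kei_fix in H
  | H : is_true (?x == kei ?x _) |- _ => rewrite eq_sym kei_fix in H
  | H : is_true (_ == _) |- _ => move/eqP in H; subst
  | H : context [match ?v with nil => _ | cons _ _ => _ end] |- _ =>
      is_var v; destruct v; simpl in H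
  end.

Ltac solve_hull :=
  let Q := fresh "Q" in let Qcl := fresh "Qcl" in
  move=> Q Qcl; rewrite /= ?cats0; do 9?[rewrite all_cat /=];
  rewrite -?kei_distr ?kei_keil;
  repeat match goal with
  | Qx : Q ?x = _ |- context [Q ?x] => rewrite Qx
  | Qx : Q ?x = true |- context [Q (kei ?x ?y)] =>
      rewrite (closed_keiE y Qcl Qx)
  | |- context [Q ?x] =>
      is_var x; let Qx := fresh "Qx" in destruct (Q x) eqn:Qx
  | |- context [all Q ?v] => is_var v; destruct (all Q v)
  end; rewrite /= ?andbF //; do 3![rewrite ?Qcl //].

Ltac solve_transfer x w t :=
  exists (trace x w t); split;
  [ by rewrite /= -?kei_distr ?kei_keil ?keixx ?keiK ?eqxx
  | by rewrite /= -?kei_distr ?kei_keil ?keixx ?keiK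
  | solve_hull ].

(** The color of a new arc is searched for among the colors at hand, then among reflections of one
    of them in another. *)
Ltac solve_transfers :=
  let w := fresh "w" in let c := fresh "c" in let H := fresh "H" in
  let W := fresh "W" in
  move=> [|? [|? w]] c H W; rewrite /= in H W; split_run;
  match goal with
  | x : GRing.Zmodule.sort V |- exists c', [/\ is_true (run ?w ?t c'), _ & _] =>
      solve_transfer x w t
  | x : GRing.Zmodule.sort V, y : GRing.Zmodule.sort V
    |- exists c', [/\ is_true (run ?w ?t c'), _ & _] =>
      solve_transfer (kei x y) w t
  end.

Definition interchangeable s t := transfers s t /\ transfers t s.

Lemma interchangeable_shift s t :
  interchangeable s t -> interchangeable (shift s) (shift t).
Proof. by case=> st ts; split; apply: transfers_shift. Qed.

Lemma interchangeable_zigzagl :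
  interchangeable [:: (cup, 0); (cap, 1)]
    [::].
Proof. split; solve_transfers. Qed.

Lemma interchangeable_zigzagr :
  interchangeable [:: (cup, 1); (cap, 0)]
    [::].
Proof. split; solve_transfers. Qed.

Lemma interchangeable_slide_cup (b : bool) :
  interchangeable [:: (cup, 0); (crossing b, 1)]
    [:: (cup, 1); (crossing (~~ b), 0)].
Proof. case: b; split; solve_transfers. Qed.

Lemma interchangeable_slide_cap (b : bool) :
  interchangeable [:: (crossing b, 0); (cap, 1)]
    [:: (crossing (~~ b), 1); (cap, 0)].
Proof. case: b; split; solve_transfers. Qed.

Lemma interchangeable_reidemeister1_cup (b : bool) :
  interchangeable [:: (cup, 0); (crossing b, 0)]
    [:: (cup, 0)].
Proof. case: b; split; solve_transfers. Qed.

Lemma interchangeable_reidemeister1_cap (b : bool) :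
  interchangeable [:: (crossing b, 0); (cap, 0)]
    [:: (cap, 0)].
Proof. case: b; split; solve_transfers. Qed.

Lemma interchangeable_reidemeister2 (b : bool) :
  interchangeable [:: (crossing b, 0); (crossing (~~ b), 0)]
    [::].
Proof. case: b; split; solve_transfers. Qed.

Lemma interchangeable_reidemeister3 (a b c : bool) : (b == a) || (b == c) ->
  interchangeable [:: (crossing a, 0); (crossing b, 1); (crossing c, 0)]
    [:: (crossing c, 1); (crossing b, 0); (crossing a, 1)].
Proof. case: a; case: b; case: c => // _; split; solve_transfers. Qed.

(** Only the row between the two slabs is new: its left strands come from one end of the pair and
    its right strands from the other. *)
Lemma interchangeable_exchange (e f : piece) (k : nat) :
  interchangeable [:: (e, 0); (f, outs e + k)%N] [:: (f, ins e + k)%N; (e, 0)].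
Proof.
split=> w [|w1 [|w2 [|? ?]]]; rewrite /= ?andbF ?andbT // => /andP[].
- case: e => [||b] st1 st2 _; rewrite /= in st1 st2; [| |case: b st1 => st1];
    split_run; lazymatch goal with
    | |- exists c', [/\ _, last ?w c' = [:: ?x, ?x & ?v'] & _] =>
      exists [:: v'; [:: x, x & v']]
    | |- exists c', [/\ _, last [:: ?x, ?y & _] c' = [:: ?z, ?t & ?v'] & _] =>
      exists [:: [:: x, y & v']; [:: z, t & v']]
    | |- exists c', [/\ _, last [:: ?x, ?y & _] c' = ?v' & _] =>
      exists [:: [:: x, y & v']; v']
    end; (split; [by rewrite /= ?eqxx ?andbT | by [] | solve_hull]).
- case: e => [||b] st1 st2 _; rewrite /= in st1 st2; [| |case: b st2 => st2];
    split_run; lazymatch goal with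
    | |- exists c', [/\ _, last ?w c' = [:: ?x, ?x & ?v'] & _] =>
      exists [:: [:: x, x & w]; [:: x, x & v']]
    | |- exists c', [/\ _, last [:: ?x, ?y & ?v] c' = [:: ?z, ?t & ?v'] & _] =>
      exists [:: [:: z, t & v]; [:: z, t & v']]
    | |- exists c', [/\ _, last [:: ?x, ?y & ?v] c' = ?v' & _] =>
      exists [:: v; v']
    end; (split; [by rewrite /= ?eqxx ?andbT | by [] | solve_hull]).
Qed.

Lemma interchangeable_local_move s t : local_move s t -> interchangeable s t.
Proof.
case=> [e f i k|i|i|b i|b i|b i|b i|b i|a b c i abc]; elim: i => [|i IHi];
  try exact: interchangeable_shift IHi.
- exact: interchangeable_exchange.
- exact: interchangeable_zigzagl.
- exact: interchangeable_zigzagr.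
- exact: interchangeable_slide_cup.
- exact: interchangeable_slide_cap.
- exact: interchangeable_reidemeister1_cup.
- exact: interchangeable_reidemeister1_cap.
- exact: interchangeable_reidemeister2.
- exact: interchangeable_reidemeister3.
Qed.

(** * Transport of closed colorings along isotopies *)

Lemma run_cat w s t c :
  run w (s ++ t) c ->
  exists c1 c2, [/\ c = c1 ++ c2, run w s c1 & run (last w c1) t c2].
Proof.
elim: s w c => [|[e i] s IHs] w c /=; first by exists [::], c.
case: c => // w' c /andP[st /IHs[c1 [c2 [-> run1 run2]]]].
by exists (w' :: c1), c2; rewrite /= st.
Qed.

Lemma cat_run w s t c1 c2 :
  run w s c1 -> run (last w c1) t c2 -> run w (s ++ t) (c1 ++ c2).
Proof.
elim: s w c1 => [|[e i] s IHs] w [|w' c1] //= /andP[-> run1] run2 /=.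
exact: IHs run1 run2.
Qed.

Lemma width_cat m s t : width m (s ++ t) = obind (width^~ t) (width m s).
Proof. by elim: s m => //= -[e i] s IHs m; case: ifP. Qed.

Lemma size_step e i w w' : step e i w w' ->
  (i + ins e <= size w)%N /\ size w' = (size w - ins e + outs e)%N.
Proof.
elim: i w w' => [|i IHi] w w' /=; last first.
  case: w w' => [|x w] [|y w'] //= /andP[_ /IHi[le_i ->]].
  rewrite addSn ltnS; split=> //.
  by rewrite subSn // (leq_trans _ le_i) ?leq_addl.
rewrite /step; case: e => [||[]] st; rewrite /= in st; split_run;
 by rewrite /= ?subn0 ?subn2 ?addn0 ?addn2.
Qed.

Lemma width_run w s c : run w s c -> width (size w) s = Some (size (last w c)).
Proof.
elim: s w c => [|[e i] s IHs] w [|w' c] //= /andP[/size_step[-> <-]].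
exact: IHs.
Qed.

Definition closed_run (D : seq slab) c := run [::] D c /\ last [::] c = [::].

Lemma closed_run_transfers A s t B c :
  transfers s t -> width 0 (A ++ t ++ B) = Some 0%N ->
  closed_run (A ++ s ++ B) c ->
  exists2 c', closed_run (A ++ t ++ B) c' & same_hull (flatten c) (flatten c').
Proof.
move=> st wD [/run_cat[cA [c0 [-> runA /run_cat[cs [cB [-> runs runB]]]]]] lastD].
move: wD; rewrite !width_cat (width_run runA) /= width_cat => wD.
have [|ct [runt eq_last hull]] := st _ _ runs; first by case: width wD.
exists (cA ++ ct ++ cB).
  split; last by rewrite !last_cat eq_last -!last_cat.
  by apply: cat_run runA (cat_run runt _); rewrite eq_last.
move=> S Scl; have := hull S Scl; rewrite /= !flatten_cat !all_cat.
(* The row entering the replaced part is the last row of [cA], or empty; its colors are already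
   counted in [cA]. *)
have: all S (flatten cA) -> all S (last [::] cA).
  case/lastP: cA {runA runs runB hull lastD wD runt eq_last} => // cA v.
  by rewrite flatten_rcons all_cat last_rcons => /andP[].
by case: (all S (flatten cA)) => //= -> //= ->.
Qed.

Lemma move_closed_run (D D' : diagram) : Defs.move D D' ->
  (forall c, closed_run D c ->
     exists2 c', closed_run D' c' & same_hull (flatten c) (flatten c')) /\
  (forall c, closed_run D' c ->
     exists2 c', closed_run D c' & same_hull (flatten c) (flatten c')).
Proof.
case: D D' => [D wD] [D' wD'] [A [B [s [t [/interchangeable_local_move[st ts]]]]]].
move=> /= eD eD'; subst D D'.
by split=> c; apply: closed_run_transfers => //; apply/eqP.
Qed.

Lemma isotopic_closed_run (D D' : diagram) c : isotopic D D' ->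
  closed_run D c ->
  exists2 c', closed_run D' c' & same_hull (flatten c) (flatten c').
Proof.
move=> DD'; suff [+ _]: (forall c, closed_run D c ->
     exists2 c', closed_run D' c' & same_hull (flatten c) (flatten c')) /\
  (forall c, closed_run D' c ->
     exists2 c', closed_run D c' & same_hull (flatten c) (flatten c')).
  exact.
elim: DD' => {D D' c} [D D' /move_closed_run //|D|D D' _ [] //|].
  by split=> c run_c; exists c.
move=> D1 D2 D3 _ [H12 H21] _ [H23 H32]; split=> c.
  case/H12=> c2 /H23[c3 run3 h23] h12; exists c3 => // S Scl.
  by rewrite h12 // h23.
case/H32=> c2 /H21[c3 run3 h23] h12; exists c3 => // S Scl.
by rewrite h12 // h23.
Qed.

(** A crossing adds the difference of the two colors to each of them: [kei x y] is [x + (x - y)],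
    and [x] is [y + (x - y)]. The difference itself is unchanged. *)
Lemma run_crossings (x y : V) v n c :
  run (x :: y :: v) (nseq n (crossing true, 0%N)) c ->
  last (x :: y :: v) c = [:: x + (x - y) *+ n, y + (x - y) *+ n & v].
Proof.
elim: n x y c => [|n IHn] x y [|w c] //=; first by rewrite !addr0.
case: w => [|z [|t w]]; rewrite /= ?andbF // => /andP[/and3P[]].
move=> /eqP-> /eqP-> /eqP-> /IHn ->; rewrite /kei.
have ->: x *+ 2 - y - x = x - y by rewrite mulr2n addrAC addrK.
by rewrite mulr2n [(x - y) *+ n.+1]mulrS !addrA [y + x]addrC addrK.
Qed.

Lemma crossings_closed S w (b : bool) n c : kei_closed S ->
  all S w -> run w (nseq n (crossing b, 0%N)) c -> all S (flatten c).
Proof.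
move=> Scl; elim: n w c => [|n IHn] w [|w' c] //= Sw /andP[st run_c].
suff Sw' : all S w' by rewrite all_cat Sw' (IHn w').
case: b st {IHn run_c} => st; split_run; case/and3P: Sw => Sx Sy Sv;
  by apply/and3P; split=> //; apply: Scl.
Qed.

(** This lets a torsion bound checked on the standard diagram pass to all isotopic diagrams through
    [same_hull]. *)
Lemma torsion_kei_closed x n : kei_closed [pred z : V | (z - x) *+ n == 0].
Proof.
move=> y z /= /eqP yx /eqP zx.
have ->: kei y z - x = (y - x) *+ 2 - (z - x).
  by rewrite /kei opprB mulrnBl (mulr2n x) opprD !addrA subrK addrAC.
by rewrite (mulrnBl n) mulrnAC yx zx mul0rn subrr.
Qed.

(** The two minima give the row [x, y, y, x]. The closing maxima force [y + (x - y) *+ n] to be [y],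
    so [n] kills [y - x]; all other colors are generated by [x] and [y]. *)
Lemma torus2_closed_run n c : closed_run (torus2_slabs n) c ->
  exists x, all [pred z : V | (z - x) *+ n == 0] (flatten c).
Proof.
case; case: c => [|w1 [|w2 c]] //=; first by rewrite andbF.
case: w1 => [|x [|x1 [|? ?]]]; rewrite /= ?andbF // => /andP[/andP[/eqP<- _]].
case: w2 => [|x2 [|y [|y1 v]]]; rewrite /= ?andbF // => /andP[].
move=> /and3P[/eqP<- /eqP<- /eqP<-] /run_cat[c1 [c2 [-> run1 run2]]] _.
exists x; have Scl := @torsion_kei_closed x n.
have:= run2; rewrite (run_crossings run1); case: c2 {run2} => [|w3 [|w4 [|? ?]]];
  rewrite /= ?andbF // andbT => /andP[].
case: w3 => [|z w3] //= /and3P[/eqP<- /eqP xyn /eqP->] /andP[/eqP zx /eqP->].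
have {xyn} yxn : (y - x) *+ n = 0.
  by apply/eqP; rewrite -opprB mulNrn oppr_eq0 -(inj_eq (addrI y)) addr0 xyn.
have Sx : (x - x) *+ n == 0 by rewrite subrr mul0rn.
rewrite !flatten_cat !all_cat /= yxn zx Sx eqxx !andbT /=.
by apply: crossings_closed run1 => //=; rewrite Sx yxn eqxx.
Qed.

Lemma isotopic_torus2_torsion (D : diagram) n c :
  isotopic (torus2_diagram n) D -> closed_run D c ->
  {in flatten c &, forall x y, (x - y) *+ n = 0}.
Proof.
move=> /(rst_sym _ _ _ _) iD /(isotopic_closed_run iD)[c' /torus2_closed_run[x]].
move=> torsc' hull; move: torsc'; rewrite -hull; last exact: torsion_kei_closed.
move=> /allP tors y z /tors /eqP yx /tors /eqP zx.
by rewrite -[y](subrK x) -addrA -(opprB z x) (mulrnBl n) yx zx subrr.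
Qed.

(** A single point is closed under [kei], so colorings with the same hull are constant together. *)
Lemma isotopic_nontrivial (D D' : diagram) c :
  isotopic D D' -> closed_run D c -> ~~ constant (flatten c) ->
  exists2 c', closed_run D' c' & ~~ constant (flatten c').
Proof.
move=> iD run_c; apply: contraNP => noc'.
have [c' run_c' hull] := isotopic_closed_run iD run_c.
have: constant (flatten c') by apply: contra_notT noc' => ?; exists c'.
case: (flatten c') hull => [|x s] hull /= const_s.
  (* The empty set is closed too: if one coloring has no colors, neither has the other. *)
  by have := hull pred0 (fun _ _ pred0x _ => pred0x); case: flatten.
have {}hull : all (pred1 x) (flatten c).
  by rewrite hull /= ?eqxx // => y z /= /eqP-> /eqP->; rewrite keixx.
case: flatten hull => //= y t /andP[/eqP-> xt].
by apply: sub_all xt => z /= /eqP->.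
Qed.
End Runs.

(** * Colorings with few colors *)

Section Recoloring.
Local Open Scope ring_scope.

(** Compatibility is asked only where [kei x y] is itself in [T], which is enough because all three
    colors of a crossing occur in the coloring. *)
Definition kei_hom_on (V W : zmodType) (T : seq V) (f : V -> W) :=
  {in T &, forall x y, kei x y \in T -> f (kei x y) = kei (f x) (f y)}.

Lemma piece_step_map (V W : zmodType) (T : seq V) (f : V -> W) e w w' :
  kei_hom_on T f -> {subset w <= T} -> {subset w' <= T} ->
  piece_step e w w' -> piece_step e (map f w) (map f w').
Proof.
move=> f_hom wT w'T; case: e => [||[]] /=.
- case: w' w'T => [|x [|y w']] // _; rewrite ?andbF // => /andP[/eqP-> /eqP->].
  by rewrite /= !eqxx.
- case: w wT => [|x [|y w]] // _; rewrite ?andbF // => /andP[/eqP-> /eqP->].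
  by rewrite /= !eqxx.
- case: w w' wT w'T => [|x [|y w]] // [|z [|t w']] // wT w'T.
  move=> /and3P[/eqP ez /eqP-> /eqP->]; rewrite /= ez f_hom ?eqxx //.
  + by apply: wT; rewrite mem_head.
  + by apply: wT; rewrite !inE eqxx orbT.
  + by rewrite -ez; apply: w'T; rewrite mem_head.
- case: w w' wT w'T => [|x [|y w]] // [|z [|t w']] // wT w'T.
  move=> /and3P[/eqP-> /eqP et /eqP->]; rewrite /= et f_hom ?eqxx //.
  + by apply: wT; rewrite !inE eqxx orbT.
  + by apply: wT; rewrite mem_head.
  + by rewrite -et; apply: w'T; rewrite !inE eqxx orbT.
Qed.

Lemma step_map (V W : zmodType) (T : seq V) (f : V -> W) e i w w' :
  kei_hom_on T f -> {subset w <= T} -> {subset w' <= T} ->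
  step e i w w' -> step e i (map f w) (map f w').
Proof.
move=> f_hom; elim: i w w' => [|i IHi] w w' wT w'T.
  exact: piece_step_map f_hom wT w'T.
case: w w' wT w'T => [|x w] // [|y w'] // wT w'T /= /andP[/eqP-> /IHi ->].
- by rewrite eqxx.
- by move=> z wz; apply: wT; rewrite inE wz orbT.
- by move=> z wz; apply: w'T; rewrite inE wz orbT.
Qed.

Lemma run_map (V W : zmodType) (T : seq V) (f : V -> W) w D c :
  kei_hom_on T f -> {subset flatten (w :: c) <= T} ->
  run w D c -> run (map f w) D (map (map f) c).
Proof.
move=> f_hom; elim: D w c => [|[e i] D IHD] w [|w' c] //= wcT /andP[st run_c].
have wT : {subset w <= T} by move=> z wz; apply: wcT; rewrite mem_cat wz.
have w'cT : {subset w' ++ flatten c <= T}.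
  by move=> z wz; apply: wcT; rewrite mem_cat wz orbT.
rewrite (IHD w') // andbT; apply: (step_map f_hom) st => // z wz; apply: w'cT.
by rewrite mem_cat wz.
Qed.

(** The map [f] produces a coloring by integers, whose differences are killed by [n]; as the
    integers are torsion-free, these differences vanish. *)
Lemma torus2_recoloring (V : zmodType) (D : diagram) n (c : seq (seq V))
    (f : V -> int) : (0 < n)%N -> isotopic (torus2_diagram n) D ->
  closed_run D c -> kei_hom_on (flatten c) f ->
  {in flatten c &, forall x y, f x = f y}.
Proof.
move=> n_gt0 iD [run_c last_c] f_hom x y cx cy.
have run_fc : closed_run D (map (map f) c).
  split; first by apply: (run_map (w := [::]) f_hom).
  by rewrite -[[::]]/(map f [::]) last_map last_c.
have in_fc z : z \in flatten c -> f z \in flatten (map (map f) c).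
  by move=> cz; rewrite -map_flatten map_f.
have /eqP := isotopic_torus2_torsion iD run_fc (in_fc x cx) (in_fc y cy).
by rewrite mulrn_eq0 subr_eq0 eqn0Ngt n_gt0 => /eqP.
Qed.

Definition separated (V : zmodType) (T : seq V) :=
  exists f : V -> int, kei_hom_on T f /\
    exists x y, [/\ x \in T, y \in T & f x != f y].

Lemma separated_eqi (V : zmodType) (T T' : seq V) :
  T =i T' -> separated T -> separated T'.
Proof.
move=> eqT [f [f_hom [x [y [Tx Ty fxy]]]]]; exists f; split.
  by move=> u v; rewrite -!eqT; apply: f_hom.
by exists x, y; rewrite -!eqT.
Qed.

Lemma kei_eqr (V : zmodType) (x y : V) : (kei x y == y) = ((x - y) *+ 2 == 0).
Proof. by rewrite /kei mulrnBl subr_eq -mulr2n -subr_eq0. Qed.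

(** The hypotheses exclude that reflecting one of the points in the other gives [a] or [b], so only
    the relations [keixx] have to be preserved. *)
Lemma separated2 (V : zmodType) (a b : V) :
  a != b -> (a - b) *+ 2 != 0 -> separated [:: a; b].
Proof.
move=> ab ab2; have ba2 : (b - a) *+ 2 != 0.
  by rewrite -opprB mulNrn oppr_eq0.
exists (fun z => (z == b)%:R : int); split; last first.
  by exists a, b; rewrite !inE !eqxx orbT (negbTE ab).
move=> x y; rewrite !inE => /orP[]/eqP-> /orP[]/eqP->; rewrite ?keixx //.
  by rewrite kei_fix kei_eqr [b == a]eq_sym (negbTE ab) (negbTE ab2).
by rewrite kei_fix kei_eqr (negbTE ab) (negbTE ba2).
Qed.

(** An equality [kei x y = z] makes [x] the midpoint of [y] and [z]. As neither [a] nor [c] is a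
    midpoint here, the only possible relation has [b] in the middle, and the integers 1, 0, -1
    satisfy it. *)
Lemma separated3 (V : zmodType) (a b c : V) :
  uniq [:: a; b; c] ->
  {in [:: a; b; c] &, forall x y, (x - y) *+ 2 = 0 -> x = y} ->
  kei a b != c -> kei c a != b -> separated [:: a; b; c].
Proof.
rewrite /= !inE negb_or andbT => /andP[/andP[ab ac] bc] no2 abc cab.
have acb : kei a c != b by apply: contraNneq abc => <-; rewrite keiK.
have cba : kei c b != a by apply: contraNneq cab => <-; rewrite keiK.
pose f z : int := if z == b then 0 else if z == a then 1 else -1.
have fa : f a = 1 by rewrite /f (negbTE ab) eqxx.
have fb : f b = 0 by rewrite /f eqxx.
have fc : f c = -1 by rewrite /f eq_sym (negbTE bc) eq_sym (negbTE ac).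
exists f; split; last by exists a, b; rewrite fa fb !inE !eqxx orbT.
have eqF x y : x \in [:: a; b; c] -> y \in [:: a; b; c] -> x != y ->
    (kei x y == y) = false /\ (kei x y == x) = false.
  move=> Tx Ty xy; rewrite kei_fix kei_eqr [y == x]eq_sym (negbTE xy); split=> //.
  by apply: contraNF xy => /eqP /no2 ->.
move=> x y Tx Ty; have := eqF x y Tx Ty; move: Tx Ty.
rewrite !inE => /or3P[]/eqP-> /or3P[]/eqP->; rewrite ?keixx //.
all: rewrite ?ab ?ac ?bc ?[b == a]eq_sym ?[c == a]eq_sym ?[c == b]eq_sym ?ab ?ac ?bc.
all: case=> // -> ->; rewrite ?orbF /= ?(negbTE abc) ?(negbTE acb) ?(negbTE cab) ?(negbTE cba) //.
(* What remains is [kei b a = c] and [kei b c = a]. *)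
all: by move=> /eqP ->; rewrite ?fa ?fb ?fc.
Qed.

Definition no_torsion (V : zmodType) (m : nat) (T : seq V) :=
  {in T &, forall x y, (x - y) *+ m = 0 -> x = y}.

Lemma no_torsion_eqi (V : zmodType) (m : nat) (T T' : seq V) :
  T =i T' -> no_torsion m T -> no_torsion m T'.
Proof. by move=> eqT torsT x y; rewrite -!eqT; apply: torsT. Qed.

Lemma size_undup_constant (T : eqType) (s : seq T) :
  (size (undup s) <= 1)%N = constant s.
Proof.
case: s => // x s; apply/idP/idP => [le1|sx].
  apply/allP => y sy; apply: contraLR le1 => yx; rewrite -ltnNge.
  apply: (@uniq_leq_size _ [:: y; x]); first by rewrite /= inE (yx : y != x).
  by move=> z; rewrite mem_undup !inE => /orP[]/eqP->; rewrite ?sy ?eqxx ?orbT.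
apply: (@uniq_leq_size _ _ [:: x]) (undup_uniq _) _ => z.
by rewrite mem_undup !inE => /orP[//|/(allP sx)].
Qed.

(** The difference of the two sides is three times [x - y]. Hence, without 3-torsion, two of three
    distinct colors cannot both be midpoints of the others. *)
Lemma kei_eq_torsion (V : zmodType) (x y : V) :
  kei x y = kei y x -> (x - y) *+ 3 = 0.
Proof.
move/eqP; rewrite -subr_eq0 => /eqP <-.
by rewrite /kei opprB (mulrnBl 3) [x *+ 3]mulrSr [y *+ 3]mulrS opprD addrACA.
Qed.

Lemma few_colors2 (V : zmodType) (T : seq V) : ~~ constant T ->
  no_torsion 2 T -> (size (undup T) <= 2)%N -> separated T.
Proof.
rewrite -size_undup_constant => nT tors2 le2; apply: separated_eqi (mem_undup T) _.
have := no_torsion_eqi (fun x => esym (mem_undup T x)) tors2.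
have := undup_uniq T.
case: (undup T) nT le2 => [|a [|b [|? ?]]] //= _ _; rewrite inE andbT => ab tors.
apply: separated2 => //; apply: contraNneq ab => /tors ->; rewrite ?inE ?eqxx //.
by rewrite orbT.
Qed.

(** The cases are: [a] is a midpoint, [c] is one, or neither. The colors are permuted so that a
    midpoint takes the second place in [separated3]. *)
Lemma few_colors3 (V : zmodType) (T : seq V) : ~~ constant T ->
  no_torsion 2 T -> no_torsion 3 T -> (size (undup T) <= 3)%N -> separated T.
Proof.
move=> nT tors2 tors3; rewrite leq_eqVlt ltnS => /orP[sz|]; last exact: few_colors2.
apply: separated_eqi (mem_undup T) _.
have := no_torsion_eqi (fun x => esym (mem_undup T x)) tors2.
have := no_torsion_eqi (fun x => esym (mem_undup T x)) tors3.
have := undup_uniq T.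
case: (undup T) sz => [|a [|b [|c [|? ?]]]] // _ uniqT.
have [Ta Tb Tc] : [/\ a \in [:: a; b; c], b \in [:: a; b; c] & c \in [:: a; b; c]].
  by rewrite !inE !eqxx !orbT.
move=> {}tors3 {}tors2.
have noswap x y z : x \in [:: a; b; c] -> y \in [:: a; b; c] -> x != y ->
    kei x y = z -> kei y x != z.
  move=> Tx Ty xy xyz; apply: contraNneq xy => yxz; apply/eqP/tors3 => //.
  by apply: kei_eq_torsion; rewrite xyz yxz.
have [[ab ac] bc] : (a != b /\ a != c) /\ b != c.
  by move: uniqT; rewrite /= !inE negb_or andbT => /andP[/andP[]].
have [abc|abc] := eqVneq (kei a b) c.
  have acb : kei a c = b by rewrite -abc keiK.
  apply: (@separated_eqi _ [:: b; a; c]); first by move=> x; rewrite !inE orbCA.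
  apply: separated3.
  - by rewrite /= !inE negb_or eq_sym ab bc ac.
  - by apply: no_torsion_eqi tors2 => x; rewrite !inE orbCA.
  - exact: noswap abc.
  - by apply: contraNneq (noswap _ _ _ Ta Tc ac acb) => <-; rewrite keiK.
have [cab|cab] := eqVneq (kei c a) b; last exact: separated3.
have cba : kei c b = a by rewrite -cab keiK.
apply: (@separated_eqi _ [:: a; c; b]).
  by move=> x; rewrite !inE [(x == c) || _]orbC.
have cNa : c != a by rewrite eq_sym.
have cNb : c != b by rewrite eq_sym.
apply: separated3.
- by rewrite /= !inE negb_or ab ac cNb.
- by apply: no_torsion_eqi tors2 => x; rewrite !inE [(x == b) || _]orbC.
- exact: noswap cab.
- by apply: contraNneq (noswap _ _ _ Tc Tb cNb cba) => <-; rewrite keiK.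
Qed.
End Recoloring.

(** * A block of crossings with few colors *)

Section TangleIsotopy.

(** Isotopy is defined for closed diagrams only, so a tangle is tested inside every closed diagram
    that contains it. *)
Definition tangle_isotopic (m m' : nat) (s t : seq slab) :=
  [/\ width m s = Some m', width m t = Some m'
    & forall A B (D D' : diagram), width 0 A = Some m ->
        slabs D = A ++ s ++ B -> slabs D' = A ++ t ++ B -> isotopic D D'].

Lemma tangle_isotopic_refl m m' s :
  width m s = Some m' -> tangle_isotopic m m' s s.
Proof.
move=> ws; split=> // A B D D' _ eD eD'.
by rewrite (val_inj (etrans eD (esym eD')) : D = D'); apply: rst_refl.
Qed.

Lemma tangle_isotopic_sym m m' s t :
  tangle_isotopic m m' s t -> tangle_isotopic m m' t s.
Proof.
case=> ws wt st; split=> // A B D D' wA eD eD'.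
by apply: rst_sym; apply: st wA eD' eD.
Qed.

Lemma tangle_isotopic_trans m m' s t u :
  tangle_isotopic m m' s t -> tangle_isotopic m m' t u ->
  tangle_isotopic m m' s u.
Proof.
case=> ws wt st [_ wu tu]; split=> // A B D D' wA eD eD'.
have wD : width 0 (A ++ t ++ B) == Some 0.
  have := slabs_closed D; rewrite eD !width_cat wA /= !width_cat wt ws.
  exact.
by apply: rst_trans (st A B D (Diagram wD) _ _ _) (tu A B _ D' _ _ _).
Qed.

Lemma tangle_isotopic_cat m m1 m2 s s' t t' :
  tangle_isotopic m m1 s s' -> tangle_isotopic m1 m2 t t' ->
  tangle_isotopic m m2 (s ++ t) (s' ++ t').
Proof.
case=> ws ws' ss' [wt wt' tt'].
apply: (@tangle_isotopic_trans _ _ _ (s' ++ t)).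
  split; rewrite ?width_cat ?ws ?ws' //= => A B D D' wA eD eD'.
  by apply: (ss' A (t ++ B)) => //; rewrite ?eD ?eD' !catA.
split; rewrite ?width_cat ?ws ?ws' //= => A B D D' wA eD eD'.
apply: (tt' (A ++ s') B); last 2 first.
- by rewrite eD !catA.
- by rewrite eD' !catA.
by rewrite width_cat wA.
Qed.

Lemma tangle_isotopic_move m m' s t : local_move s t ->
  width m s = Some m' -> width m t = Some m' -> tangle_isotopic m m' s t.
Proof.
move=> st ws wt; split=> // A B D D' _ eD eD'.
by apply: rst_step; exists A, B, s, t.
Qed.

Lemma width_nseq_crossing m n b i :
  (i + 2 <= m)%N -> width m (nseq n (crossing b, i)) = Some m.
Proof.
by move=> le_m; elim: n => //= n IHn; rewrite le_m subnK // (leq_trans _ le_m) ?leq_addl.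
Qed.

Notation "''s_' i" := (crossing true, i%N) (at level 8, i at level 2).

(** Reidemeister III passes one crossing at a time through ['s_0] and ['s_1]. Width 6 counts the
    four strands of the closed braid and the two added by the minimum of [short_block]. *)
Lemma crossings_braid k :
  tangle_isotopic 6 6 (nseq k 's_1 ++ [:: 's_0; 's_1])
                      ([:: 's_0; 's_1] ++ nseq k 's_0).
Proof.
elim: k => [|k IHk]; first exact: tangle_isotopic_refl.
apply: (@tangle_isotopic_trans _ _ _ ([:: 's_1; 's_0; 's_1] ++ nseq k 's_0)).
  by apply: (@tangle_isotopic_cat _ 6 _ [:: 's_1] [:: 's_1]) IHk;
    apply: tangle_isotopic_refl.
apply: (@tangle_isotopic_cat _ 6 _ _ [:: 's_0; 's_1; 's_0] _ (nseq k 's_0)).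
  apply: tangle_isotopic_sym; apply: tangle_isotopic_move => //.
  exact: (@reidemeister3 true true true 0).
by apply: tangle_isotopic_refl; apply: width_nseq_crossing.
Qed.

Lemma crossings_cap k :
  tangle_isotopic 6 4 (nseq k 's_0 ++ [:: (cap, 2%N)])
                      ([:: (cap, 2%N)] ++ nseq k 's_0).
Proof.
elim: k => [|k IHk]; first exact: tangle_isotopic_refl.
apply: (@tangle_isotopic_trans _ _ _ ([:: 's_0; (cap, 2%N)] ++ nseq k 's_0)).
  by apply: (@tangle_isotopic_cat _ 6 _ [:: 's_0] [:: 's_0]) IHk;
    apply: tangle_isotopic_refl.
apply: (@tangle_isotopic_cat _ 4 _ _ [:: (cap, 2%N); 's_0] _ (nseq k 's_0)).
  apply: tangle_isotopic_move => //.
  exact: (@exchange (crossing true) cap 0 0).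
by apply: tangle_isotopic_refl; apply: width_nseq_crossing.
Qed.

(** Sliding the crossing around the maximum makes it a kink on the minimum; Reidemeister I removes
    it, and a zigzag is left to straighten. *)
Lemma cup_crossing_cap :
  tangle_isotopic 4 4 [:: (cup, 2%N); 's_1; (cap, 2%N)] [::].
Proof.
apply: (@tangle_isotopic_trans _ _ _ [:: (cup, 2%N); (crossing false, 2%N); (cap, 1%N)]).
  apply: (@tangle_isotopic_cat _ 6 _ [:: (cup, 2%N)] [:: (cup, 2%N)]).
    exact: tangle_isotopic_refl.
  apply: tangle_isotopic_move => //; exact: (@slide_cap true 1).
apply: (@tangle_isotopic_trans _ _ _ [:: (cup, 2%N); (cap, 1%N)]).
  apply: (@tangle_isotopic_cat _ 6 _ [:: (cup, 2%N); (crossing false, 2%N)] [:: (cup, 2%N)]).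
    by apply: tangle_isotopic_move => //; apply: reidemeister1_cup.
  exact: tangle_isotopic_refl.
by apply: tangle_isotopic_move => //; apply: zigzagr.
Qed.

(** It has [2 * k + 2] crossings, one more than the braid it replaces, but its colors climb half way
    and come down again instead of running through a full cycle. *)
Definition short_block k : seq slab :=
  nseq k 's_0 ++ (cup, 2%N) :: nseq k 's_1 ++ [:: 's_0; 's_1; (cap, 2%N)].

(** After the braid relation, [k] crossings ['s_0] move above the maximum and a single ['s_0] moves
    below the minimum; the kink left between them disappears. *)
Lemma short_block_isotopic k :
  tangle_isotopic 4 4 (short_block k) (nseq (2 * k + 1) 's_0).
Proof.
have wk m : (2 <= m)%N -> tangle_isotopic m m (nseq k 's_0) (nseq k 's_0).
  by move=> m2; apply: tangle_isotopic_refl; apply: width_nseq_crossing.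
have ->: nseq (2 * k + 1) 's_0 = nseq k 's_0 ++ [:: 's_0] ++ nseq k 's_0.
  by rewrite -[[:: 's_0]]/(nseq 1 _) -!nseqD addn1 addnS mul2n addnn.
apply: tangle_isotopic_cat (wk 4 isT) _.
apply: (@tangle_isotopic_trans _ _ _
  ((cup, 2%N) :: [:: 's_0; 's_1] ++ nseq k 's_0 ++ [:: (cap, 2%N)])).
  apply: (@tangle_isotopic_cat _ 6 _ [:: (cup, 2%N)] [:: (cup, 2%N)]).
    exact: tangle_isotopic_refl.
  rewrite -[[:: 's_0; _; _]]/([:: 's_0; 's_1] ++ [:: (cap, 2%N)]) !catA.
  apply: tangle_isotopic_cat (crossings_braid k) _.
  exact: tangle_isotopic_refl.
apply: (@tangle_isotopic_trans _ _ _
  ([:: (cup, 2%N); 's_0; 's_1] ++ [:: (cap, 2%N)] ++ nseq k 's_0)).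
  apply: (@tangle_isotopic_cat _ 6 _ [:: (cup, 2%N); 's_0; 's_1]).
    exact: tangle_isotopic_refl.
  exact: crossings_cap.
rewrite catA; apply: tangle_isotopic_cat (wk 4 isT).
apply: (@tangle_isotopic_trans _ _ _ [:: 's_0; (cup, 2%N); 's_1; (cap, 2%N)]).
  apply: (@tangle_isotopic_cat _ 6 _ [:: (cup, 2%N); 's_0] [:: 's_0; (cup, 2%N)]).
    apply: tangle_isotopic_sym; apply: tangle_isotopic_move => //.
    exact: (@exchange (crossing true) cup 0 0).
  exact: tangle_isotopic_refl.
apply: (@tangle_isotopic_cat _ 4 _ [:: 's_0] [:: 's_0]); last exact: cup_crossing_cap.
exact: tangle_isotopic_refl.
Qed.

Lemma tangle_isotopic_flatten m s t k : tangle_isotopic m m s t ->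
  tangle_isotopic m m (flatten (nseq k s)) (flatten (nseq k t)).
Proof.
move=> st; elim: k => [|k IHk]; first exact: tangle_isotopic_refl.
exact: tangle_isotopic_cat st IHk.
Qed.
End TangleIsotopy.

(** * Colorings of tangles with prescribed colors *)

Section Painting.
Local Open Scope ring_scope.
Variables (V : zmodType) (S : pred V).

(** The bottom row [w] is not tested against [S]: in a composite it is the top row of the part
    below. *)
Definition paints (w : seq V) (D : seq slab) (w' : seq V) :=
  exists c, [/\ run w D c, last w c = w' & all S (flatten c)].

Lemma paints_nil w : paints w [::] w. Proof. by exists [::]. Qed.

Lemma paints_cons w w1 w' e i D :
  step e i w w1 -> all S w1 -> paints w1 D w' -> paints w ((e, i) :: D) w'.
Proof.
move=> st Sw1 [c [run_c last_c Sc]]; exists (w1 :: c).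
by rewrite /= st all_cat Sw1.
Qed.

Lemma paints_cat w w1 w' D D' :
  paints w D w1 -> paints w1 D' w' -> paints w (D ++ D') w'.
Proof.
move=> [c [run_c last_c Sc]] [c' [run_c' last_c' Sc']]; exists (c ++ c').
rewrite last_cat last_c flatten_cat all_cat Sc; split=> //.
by apply: cat_run => //; rewrite last_c.
Qed.

Lemma paints_shift x w D w' :
  S x -> paints w D w' -> paints (x :: w) (shift D) (x :: w').
Proof.
move=> Sx [c [run_c last_c Sc]]; exists [seq x :: v | v <- c].
rewrite last_map last_c shift_run //; split=> //.
by elim: c {run_c last_c} Sc => //= v c IHc; rewrite Sx !all_cat => /andP[-> /IHc].
Qed.

Lemma paints_flatten w D k :
  paints w D w -> paints w (flatten (nseq k D)) w.
Proof.
by move=> wD; elim: k => [|k IHk]; [apply: paints_nil | apply: paints_cat IHk].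
Qed.

Lemma kei_mulrn (d : V) i : kei (d *+ i.+1) (d *+ i) = d *+ i.+2.
Proof.
by rewrite /kei -mulrnA muln2 -addnn addSnnS mulrnDr addrAC subrr add0r.
Qed.

Lemma kei_mulrnV (d : V) i : kei (d *+ i.+1) (d *+ i.+2) = d *+ i.
Proof. by rewrite -kei_mulrn keiK. Qed.

Lemma paints_up (d : V) k i v : (forall j, (j <= i + k.+1)%N -> S (d *+ j)) ->
  all S v ->
  paints [:: d *+ i.+1, d *+ i & v] (nseq k (crossing true, 0%N))
         [:: d *+ (i + k).+1, d *+ (i + k) & v].
Proof.
elim: k i => [|k IHk] i Sd Sv; first by rewrite addn0; apply: paints_nil.
apply: (@paints_cons _ [:: d *+ i.+2, d *+ i.+1 & v]).
- by rewrite /= kei_mulrn !eqxx.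
- by rewrite /= Sv !Sd // ?addnS ltnS ?leq_addr // -addnS leq_addr.
- by rewrite -addSnnS; apply: IHk => // j; rewrite addSnnS; apply: Sd.
Qed.

(** With the smaller multiple on the left, the constant difference is [- d], and the same crossings
    descend. *)
Lemma paints_down (d : V) k i v : (forall j, (j <= i + k.+1)%N -> S (d *+ j)) ->
  all S v ->
  paints [:: d *+ (i + k), d *+ (i + k).+1 & v] (nseq k (crossing true, 0%N))
         [:: d *+ i, d *+ i.+1 & v].
Proof.
elim: k => [|k IHk] Sd Sv; first by rewrite addn0; apply: paints_nil.
apply: (@paints_cons _ [:: d *+ (i + k), d *+ (i + k).+1 & v]).
- by rewrite addnS /= kei_mulrnV !eqxx.
- by rewrite /= Sv !Sd // !addnS // ?leqW // leqnSn.
- by apply: IHk => // j le_j; apply: Sd; rewrite addnS leqW.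
Qed.

(** The first [k] crossings climb to [(k+1)d], the new arc takes this top color, and the next [k]
    crossings bring two strands down to [0, d]. The last two crossings and the maximum restore the
    bottom row. *)
Lemma paints_short_block (d : V) k :
  (forall j, (j <= k.+1)%N -> S (d *+ j)) -> d *+ (2 * k + 1) = 0 ->
  paints [:: d; 0; 0; d] (short_block k) [:: d; 0; 0; d].
Proof.
move=> Sd dp; have S0 : S 0 by rewrite -(mulr0n d) Sd.
have S1 : S d by rewrite -[d]mulr1n Sd.
have Sk := Sd k.+1 (leqnn _).
(* The cyclic relation enters here, as [2(k+1)d = d]. *)
have keik0 : kei (d *+ k.+1) 0 = d.
  have e2 : (k.+1 * 2 = (2 * k + 1).+1)%N by rewrite mulnC mulnS addn1 add2n.
  by rewrite /kei subr0 -mulrnA e2 mulrS dp addr0.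
have keik1 : kei (d *+ k.+1) d = 0 by rewrite -[X in kei _ X]keik0 keiK.
rewrite /short_block; apply: paints_cat.
  by have := @paints_up d k 0 [:: 0; d]; rewrite mulr1n; apply=> //=; rewrite S0 S1.
rewrite add0n.
apply: (@paints_cons _ [:: d *+ k.+1; d *+ k; d *+ k.+1; d *+ k.+1; 0; d]).
- by rewrite /= !eqxx.
- by rewrite /= Sk S0 S1 Sd ?leqnSn.
apply: (@paints_cat _ [:: d *+ k.+1; 0; d; d *+ k.+1; 0; d]).
  have ->: nseq k (crossing true, 1%N) = shift (nseq k (crossing true, 0%N)).
    by rewrite /shift map_nseq.
  apply: paints_shift => //.
  have := @paints_down d k 0 [:: d *+ k.+1; 0; d]; rewrite mulr1n; apply=> //=.
  by rewrite Sk S0 S1.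
apply: (@paints_cons _ [:: d; d *+ k.+1; d; d *+ k.+1; 0; d]).
- by rewrite /= keik0 !eqxx.
- by rewrite /= Sk S0 S1.
apply: (@paints_cons _ [:: d; 0; d *+ k.+1; d *+ k.+1; 0; d]).
- by rewrite /= keik1 !eqxx.
- by rewrite /= Sk S0 S1.
apply: paints_cons (paints_nil _); last by rewrite /= S0 S1.
by rewrite /= !eqxx.
Qed.

Lemma paints_closure (x y : V) (X : seq slab) :
  S x -> S y -> paints [:: x; y; y; x] X [:: x; y; y; x] ->
  exists2 c, closed_run ([:: (cup, 0%N); (cup, 1%N)] ++ X
                           ++ [:: (cap, 1%N); (cap, 0%N)]) c
           & all S (flatten c) && [&& x \in flatten c & y \in flatten c].
Proof.
move=> Sx Sy [c [run_c last_c Sc]].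
exists ([:: [:: x; x]; [:: x; y; y; x]] ++ c ++ [:: [:: x; x]; [::]]).
  split; last by rewrite !last_cat.
  rewrite /= !eqxx /=; apply: cat_run => //.
  by rewrite last_c /= !eqxx.
rewrite /= !flatten_cat !inE !all_cat /= Sx Sy Sc !eqxx /= !orbT.
by [].
Qed.
End Painting.

(** * Agreement of [run] with Fox colorings modulo [r] *)

Section ColoredSlab.
Local Open Scope ring_scope.

Lemma colored_slabP r (s : slab) (w w' : seq 'Z_r) :
  colored_slab s w w' <-> step s.1 s.2 w w'.
Proof.
split.
  have step_cat e (u v v' : seq 'Z_r) :
      piece_step e v v' -> step e (size u) (u ++ v) (u ++ v').
    by move=> st; elim: u => //= x u ->; rewrite eqxx.
  case=> [u v x|u v x|u v x y z /eqP h|u v x y z /eqP h]; apply: step_cat.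
  - by rewrite /= !eqxx.
  - by rewrite /= !eqxx.
  - by rewrite /= /kei !eqxx /= andbT eq_sym subr_eq eq_sym -subr_eq0 [z + y]addrC.
  - by rewrite /= /kei !eqxx /= andbT eq_sym subr_eq eq_sym -subr_eq0 [z + x]addrC.
case: s => e i /= st.
have [u [v [v' [<- -> -> {}st]]]] : exists u v v',
    [/\ size u = i, w = u ++ v, w' = u ++ v' & piece_step e v v'].
  elim: i w w' st => [|i IHi] w w'; first by exists [::], w, w'.
  case: w w' => [|x w] [|y w'] //= /andP[/eqP-> /IHi[u [v [v' [<- -> -> st]]]]].
  by exists (y :: u), v, v'.
case: e st => [||[]] /=.
- case: v' => [|x [|y v']]; rewrite ?andbF // => /andP[/eqP-> /eqP->].
  exact: colored_cup.
- case: v => [|x [|y v]]; rewrite ?andbF // => /andP[/eqP-> /eqP->].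
  exact: colored_cap.
- case: v v' => [|x [|y v]] [|z [|t v']] //= /and3P[/eqP-> /eqP-> /eqP->].
  by apply: colored_crossing_left; rewrite /kei addrCA subrr addr0 subrr.
- case: v v' => [|x [|y v]] [|z [|t v']] //= /and3P[/eqP-> /eqP-> /eqP->].
  by apply: colored_crossing_right; rewrite /kei addrCA subrr addr0 subrr.
Qed.

Lemma coloringP r (D : diagram) (c : seq (seq 'Z_r)) :
  coloring D c <-> closed_run D c.
Proof.
have gen s w c0 : coloring_from w s c0 <-> run w s c0 /\ last w c0 = [::].
  elim: s w c0 => [|[e i] s IHs] w [|w' c0] /=.
  - by split=> [->|[]].
  - by split=> [[]|[]].
  - by split=> [[]|[]].
  rewrite IHs (colored_slabP (e, i)) /=.
  by split=> [[-> [-> ->]]|[/andP[-> ->] ->]].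
exact: gen.
Qed.

End ColoredSlab.

(** * Bounds for minima over colorings and diagrams *)

Lemma minimum_mem P m : P m -> P (minimum P).
Proof.
move=> Pm; rewrite /minimum; case: pselect => [exP|[]]; last first.
  by exists m; apply/asboolP.
by case: ex_minnP => k /asboolP.
Qed.

Lemma minimum_le P m : P m -> minimum P <= m.
Proof.
move=> Pm; rewrite /minimum; case: pselect => // exP.
by case: ex_minnP => k _; apply; apply/asboolP.
Qed.

Lemma mincol_le r n m (D : diagram) (c : seq (seq 'Z_r)) :
  isotopic (torus2_diagram n) D -> closed_run D c ->
  ~~ constant (flatten c) -> size (undup (flatten c)) <= m ->
  mincol r (torus2 n) <= m.
Proof.
move=> iD run_c nc; apply: leq_trans.
apply: (@leq_trans (min_colors r D)); first by apply: minimum_le; exists D.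
by apply: minimum_le; exists c => //; split=> //; apply/coloringP.
Qed.

(** Since [minimum] is 0 on the empty set, a lower bound needs a nontrivial coloring of every
    diagram; invariance supplies it from a single one. *)
Lemma mincol_ge r n m :
  (exists D (c : seq (seq 'Z_r)), [/\ isotopic (torus2_diagram n) D,
     closed_run D c & ~~ constant (flatten c)]) ->
  (forall (D : diagram) (c : seq (seq 'Z_r)), isotopic (torus2_diagram n) D ->
     closed_run D c -> ~~ constant (flatten c) ->
     m <= size (undup (flatten c))) ->
  m <= mincol r (torus2 n).
Proof.
move=> [D0 [c0 [iD0 run0 nc0]]] ge_m.
have [D iD <-] : [set min_colors r D | D in torus2 n]%classic (mincol r (torus2 n)).
  by apply: minimum_mem; exists D0.
have [c run_c nc] : exists2 c : seq (seq 'Z_r), closed_run D c & ~~ constant (flatten c).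
  apply: isotopic_nontrivial run0 nc0.
  by apply: rst_trans iD; apply: rst_sym.
rewrite /min_colors.
have [c' [/coloringP run_c' nc'] <-] := @minimum_mem
  [set num_colors c | c in
     [set c | coloring (r := r) D c /\ ~~ trivial_coloring c]]%classic
  (num_colors c) (ex_intro2 _ _ c (conj ((coloringP D c).2 run_c) nc) erefl).
exact: ge_m run_c' nc'.
Qed.

Lemma constant_mem (T : eqType) (s : seq T) :
  constant s -> {in s &, forall x y, x = y}.
Proof.
case: s => //= z s /allP sz x y.
by rewrite !inE => /orP[/eqP->|/sz/eqP->] /orP[/eqP->|/sz/eqP->].
Qed.

Lemma flatten_nseq (T : Type) (x : T) m p :
  flatten (nseq m (nseq p x)) = nseq (m * p) x.
Proof. by elim: m => //= m ->; rewrite mulSn nseqD. Qed.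

(** The end rows of [X] agree, so [n / p] copies can be stacked and closed; the result is isotopic
    to the standard diagram, copy by copy. *)
Lemma torus2_painting (V : zmodType) n p (X : seq slab) (C : seq V) x y :
  p %| n -> tangle_isotopic 4 4 X (nseq p (crossing true, 0)) ->
  x \in C -> y \in C -> x != y ->
  paints (mem C) [:: x; y; y; x] X [:: x; y; y; x] ->
  exists D (c : seq (seq V)), [/\ isotopic (torus2_diagram n) D, closed_run D c,
    ~~ constant (flatten c) & size (undup (flatten c)) <= size C].
Proof.
case/dvdnP=> m -> X_p Cx Cy xy /(paints_flatten m) /(paints_closure Cx Cy).
have := tangle_isotopic_flatten m X_p; rewrite flatten_nseq.
move: (flatten (nseq m X)) => Y Y_n [c run_c /and3P[/allP Cc cx cy]].
have wY : width 4 Y = Some 4 by case: Y_n.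
have wD : width 0 ([:: (cup, 0); (cup, 1)] ++ Y ++ [:: (cap, 1); (cap, 0)]) == Some 0.
  by rewrite /= width_cat wY.
exists (Diagram wD), c; split=> //.
- case: Y_n => _ _ Y_n; apply: rst_sym.
  exact: (Y_n [:: (cup, 0); (cup, 1)] [:: (cap, 1); (cap, 0)]).
- by apply: contra xy => /constant_mem/(_ x y cx cy)/eqP.
- by apply: uniq_leq_size (undup_uniq _) _ => z; rewrite mem_undup => /Cc.
Qed.

(** * Torsion modulo [r], and the colorings behind the upper bounds *)

Section Torsion.
Local Open Scope ring_scope.

Lemma mulrn_gcdn (V : zmodType) (z : V) a b : (0 < a)%N ->
  z *+ a = 0 -> z *+ b = 0 -> z *+ gcdn a b = 0.
Proof.
move=> a_gt0 za zb; have [q _ /dvdnP[t e]] := Bezoutl b a_gt0.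
have : z *+ (gcdn a b + q * b)%N = z *+ (t * a)%N by rewrite e.
by rewrite mulrnDr (mulnC q) (mulnC t) !mulrnA za zb !mul0rn addr0.
Qed.

Lemma Zp_torsion r (z : 'Z_r) : (1 < r)%N -> z *+ r = 0.
Proof. by move=> r_gt1; rewrite -mulr_natr pchar_Zp // mulr0. Qed.

(** A difference of colors is killed by [n] and by [r]; if [q] kills it too, so does the gcd of the
    three, which is 1. *)
Lemma torus2_no_torsion r n q (D : diagram) (c : seq (seq 'Z_r)) :
  (1 < r)%N -> (0 < n)%N -> coprime (gcdn n r) q ->
  isotopic (torus2_diagram n) D -> closed_run D c -> no_torsion q (flatten c).
Proof.
move=> r_gt1 n_gt0 /eqP co iD run_c x y cx cy xyq.
apply/eqP; rewrite -subr_eq0 -[x - y]mulr1n -co; apply/eqP.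
apply: mulrn_gcdn => //; first by rewrite gcdn_gt0 n_gt0.
apply: mulrn_gcdn => //; last exact: Zp_torsion.
exact: isotopic_torus2_torsion iD run_c _ _ cx cy.
Qed.

Lemma Zp_order r p : (1 < p)%N -> (1 < r)%N -> (p %| r)%N ->
  exists2 d : 'Z_r, d != 0 & d *+ p = 0.
Proof.
move=> p_gt1 r_gt1 p_r; exists (r %/ p)%:R.
  have lt_r : (r %/ p < r)%N by rewrite ltn_Pdiv // ltnW.
  apply/eqP => /(congr1 (fun z : 'Z_r => z : nat)).
  rewrite val_Zp_nat // modn_small // => r_p0.
  have : (0 < r %/ p)%N by rewrite divn_gt0 ?(ltnW p_gt1) // dvdn_leq // ltnW.
  by rewrite r_p0.
by rewrite -mulrnA divnK //; apply: Zp_torsion.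
Qed.

Lemma torus2_painting_even r n : (1 < r)%N -> (2 %| n)%N -> (2 %| r)%N ->
  exists D (c : seq (seq 'Z_r)), [/\ isotopic (torus2_diagram n) D,
    closed_run D c, ~~ constant (flatten c) & (size (undup (flatten c)) <= 2)%N].
Proof.
move=> r_gt1 n2 r2; have [d d_neq0 d2] := @Zp_order r 2 isT r_gt1 r2.
have step_d : d *+ 3 = d by rewrite mulrS d2 addr0.
apply: (@torus2_painting _ n 2 (nseq 2 (crossing true, 0%N)) [:: d; 0] d 0) => //.
- exact: tangle_isotopic_refl.
- by rewrite mem_head.
- by rewrite !inE eqxx orbT.
(* The block of two crossings ends in [3d, 2d], which is [d, 0] again because [2d = 0]. *)
have := @paints_up _ (mem [:: d; 0]) d 2 0 [:: 0; d].
rewrite /= mulr1n mulr0n step_d d2; apply=> [j le_j|]; rewrite ?inE ?eqxx ?orbT //.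
by case: j le_j => [|[|[|[|//]]]] _;
  rewrite /= ?step_d ?d2 ?mulr1n ?mulr0n eqxx ?orbT.
Qed.

Lemma torus2_painting_odd r n k : (1 < r)%N -> (0 < k)%N ->
  (2 * k + 1 %| n)%N -> (2 * k + 1 %| r)%N ->
  exists D (c : seq (seq 'Z_r)), [/\ isotopic (torus2_diagram n) D,
    closed_run D c, ~~ constant (flatten c) &
    (size (undup (flatten c)) <= k + 2)%N].
Proof.
move=> r_gt1 k_gt0 p_n p_r.
have p_gt1 : (1 < 2 * k + 1)%N by rewrite addn1 ltnS muln_gt0.
have [d d_neq0 dp] := Zp_order p_gt1 r_gt1 p_r.
pose C := [seq d *+ j | j <- iota 0 k.+2].
have <- : size C = (k + 2)%N by rewrite size_map size_iota addn2.
have Cd j : (j <= k.+1)%N -> d *+ j \in C.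
  by move=> le_j; apply: map_f; rewrite mem_iota.
apply: (torus2_painting (C := C) (x := d) (y := 0) p_n (short_block_isotopic k)) => //.
  exact: (Cd 1%N).
exact: paints_short_block.
Qed.
End Torsion.

(** A nontrivial coloring with at most [m] colors would have a nonconstant recoloring by integers,
    against [torus2_recoloring]. *)
Lemma mincol_ge_separated r n m :
  (exists D (c : seq (seq 'Z_r)), [/\ isotopic (torus2_diagram n) D,
     closed_run D c & ~~ constant (flatten c)]) ->
  0 < n ->
  (forall (D : diagram) (c : seq (seq 'Z_r)), isotopic (torus2_diagram n) D ->
     closed_run D c -> ~~ constant (flatten c) ->
     size (undup (flatten c)) <= m -> separated (flatten c)) ->
  m < mincol r (torus2 n).
Proof.
move=> ex n_gt0 sep; apply: mincol_ge => // D c iD run_c nc.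
rewrite ltnNge; apply/negP => /(sep D c iD run_c nc) [f [f_hom [x [y [cx cy]]]]].
by rewrite (torus2_recoloring n_gt0 iD run_c f_hom cx cy) eqxx.
Qed.

Theorem mainTheorem1 (r n : nat) (r_gt0 : 0 < r) (n_gt0 : 0 < n)
    (gcd_gt1 : 1 < gcdn n r) :
  [/\ least_common_prime n r = 2 \/ least_common_prime n r = 3 ->
        mincol r (torus2 n) = least_common_prime n r,
      least_common_prime n r = 5 -> mincol r (torus2 n) = 4
    & forall k : nat, 2 < k -> least_common_prime n r = 2 * k + 1 ->
        3 < mincol r (torus2 n) /\ mincol r (torus2 n) <= k + 2].
Proof.
have r_gt1 : 1 < r by apply: leq_trans gcd_gt1 _; rewrite dvdn_leq ?dvdn_gcdr.
rewrite /least_common_prime /coprime gtn_eqF //.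
set p := pdiv _.
have p_n : p %| n by apply: dvdn_trans (pdiv_dvd _) (dvdn_gcdl _ _).
have p_r : p %| r by apply: dvdn_trans (pdiv_dvd _) (dvdn_gcdr _ _).
(* By minimality of [p], smaller primes do not divide the gcd; this is the source of the absence of
   2-torsion and 3-torsion. *)
have co q : prime q -> q < p -> coprime (gcdn n r) q.
  move=> q_pr; rewrite coprime_sym prime_coprime // ltnNge; apply: contra => q_g.
  by apply: pdiv_min_dvd => //; apply: prime_gt1.
have upper k : 0 < k -> p = 2 * k + 1 -> mincol r (torus2 n) <= k + 2.
  move=> k_gt0 ep; rewrite ep in p_n p_r.
  have [D [c [iD run_c nc]]] := torus2_painting_odd r_gt1 k_gt0 p_n p_r.
  exact: mincol_le iD run_c nc.
have ex k : 0 < k -> p = 2 * k + 1 -> exists D (c : seq (seq 'Z_r)),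
    [/\ isotopic (torus2_diagram n) D, closed_run D c & ~~ constant (flatten c)].
  move=> k_gt0 ep; rewrite ep in p_n p_r.
  have [D [c [iD run_c nc _]]] := torus2_painting_odd r_gt1 k_gt0 p_n p_r.
  by exists D, c.
(* Here [p] is at least 5, so both 2 and 3 are below [p]. *)
have lower k : 1 < k -> p = 2 * k + 1 -> 3 < mincol r (torus2 n).
  move=> k_gt1 ep; have p_gt3 : 3 < p by rewrite ep addn1 ltnS (@leq_trans (2 * 2)) // leq_mul2l.
  apply: (mincol_ge_separated (ex k (ltnW k_gt1) ep)) => // D c iD run_c nc.
  apply: few_colors3 => //.
    by apply: torus2_no_torsion iD run_c => //; apply: co => //; apply: ltnW.
  by apply: torus2_no_torsion iD run_c => //; apply: co.
split=> [[ep|ep]|ep|k k_gt2 ep]; last 1 first.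
- by split; [apply: lower ep; apply: ltnW | apply: upper ep; apply: ltnW (ltnW _)].
- rewrite ep in p_n p_r *.
  have [D [c [iD run_c nc le2]]] := torus2_painting_even r_gt1 p_n p_r.
  apply/eqP; rewrite eqn_leq (mincol_le iD run_c nc le2).
  (* At least two colors occur simply because the coloring is not constant. *)
  apply: mincol_ge; first by exists D, c.
  by move=> D' c' _ _; rewrite -size_undup_constant -ltnNge.
(* For [p = 3] the block with [k = 1] gives 3 colors, and two colors are excluded by the absence of
   2-torsion. *)
- rewrite ep; apply/eqP; rewrite eqn_leq (upper 1) //=.
  apply: (mincol_ge_separated (ex 1 isT ep)) => // D c iD run_c nc.
  apply: few_colors2 => //.
  by apply: torus2_no_torsion iD run_c => //; apply: co => //; rewrite ep.
(* For [p = 5], that is [k = 2], the two general bounds meet at 4. *)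
- by apply/eqP; rewrite eqn_leq (upper 2) // (lower 2).
Qed.
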